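(* For every $n\ge 1$, let $\Sigma_n$ be the loopless Schreier graph of Grigorchuk's group on level $n$, with edge weights given by positive reals $a,b,c,d$ according to the labels. Then the partition function of the dimer model on $\Sigma_n$ is $$\Phi_n(a,b,c,d)=a^{2^{n-1}}.$$
   Context: Grigorchuk's group is generated by the maps $a,b,c,d$ acting on the set $\{0,1\}^n$ of binary words of length $n$ (for every $n$; the empty word is fixed). They are defined recursively, for any binary word $w$, by - $a(0w)=1w$ and $a(1w)=0w$; - $b(0w)=0a(w)$ and $b(1w)=1c(w)$; - $c(0w)=0a(w)$ and $c(1w)=1d(w)$; - $d(0w)=0w$ and $d(1w)=1b(w)$. Each of them is an involution. The loopless Schreier graph $\Sigma_n$ is defined as follows. Its vertex set is $\{0,1\}^n$. For each $s\in\{a,b,c,d\}$ and each unordered pair $\{u,s(u)\}$ with $s(u)\neq u$, there is exactly one edge labeled $s$ joining $u$ and $s(u)$. Hence $\Sigma_n$ may have parallel edges with different labels, and fixed points (loops) are omitted. Weights are assigned as follows: given positive reals, also denoted $a,b,c,d$, an edge labeled $s$ receives weight $s$. A dimer covering is a perfect matching, i.e. a set of edges such that every vertex is an endpoint of exactly one of them. Its weight is the product of the weights of its edges. The partition function $\Phi_n(a,b,c,d)$ is the sum of the weights of all dimer coverings of $\Sigma_n$. *)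

(* Defs.v *)
From HB Require Import structures.
From mathcomp Require Import all_boot all_order all_algebra.
From mathcomp Require Import reals.

Set Implicit Arguments.
Unset Strict Implicit.
Unset Printing Implicit Defensive.

Import GRing.Theory Num.Theory.
Local Open Scope ring_scope.

Inductive label := La | Lb | Lc | Ld.

Definition bits_of_label (s : label) : bool * bool :=
  match s with
  | La => (false, false)
  | Lb => (false, true)
  | Lc => (true, false)
  | Ld => (true, true)
  end.

Definition label_of_bits (p : bool * bool) : label :=
  match p with
  | (false, false) => La
  | (false, true) => Lb
  | (true, false) => Lc
  | (true, true) => Ld
  end.

Lemma bits_of_labelK : cancel bits_of_label label_of_bits.
Proof. by case. Qed.

HB.instance Definition _ := Finite.copy label (can_type bits_of_labelK).

(* A binary word is a sequence of booleans, first letter at the head, with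
   [false] for 0 and [true] for 1. *)
Fixpoint act (s : label) (w : seq bool) : seq bool :=
  match w with
  | [::] => [::]
  | x :: w' =>
    match s, x with
    | La, false => true :: w'
    | La, true => false :: w'
    | Lb, false => false :: act La w'
    | Lb, true => true :: act Lc w'
    | Lc, false => false :: act La w'
    | Lc, true => true :: act Ld w'
    | Ld, false => false :: w'
    | Ld, true => true :: act Lb w'
    end
  end.

Lemma actK (s : label) : involutive (act s).
Proof. by move=> w; elim: w s => [|[] w IHw] [] //=; rewrite IHw. Qed.

Lemma size_act (s : label) (w : seq bool) : size (act s w) = size w.
Proof. by elim: w s => [|[] w IHw] [] //=; rewrite IHw. Qed.

Lemma act_tupleP (n : nat) (s : label) (w : n.-tuple bool) :
  size (act s w) == n.
Proof. by rewrite size_act size_tuple. Qed.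

Definition tact (n : nat) (s : label) (w : n.-tuple bool) : n.-tuple bool :=
  Tuple (act_tupleP s w).

(* An edge is a label together with its unordered pair of endpoints, so that
   parallel edges with different labels are distinct. *)
Definition schreier_edges (n : nat) : {set label * {set n.-tuple bool}} :=
  [set e | [exists u : n.-tuple bool,
     (tact e.1 u != u) && (e.2 == [set u; tact e.1 u])]].

Definition dimer_covering (n : nat) (M : {set label * {set n.-tuple bool}})
    : bool :=
  (M \subset schreier_edges n) &&
  [forall v : n.-tuple bool, #|[set e in M | v \in e.2]| == 1%N].

Definition label_weight (R : realType) (a b c d : R) (s : label) : R :=
  match s with La => a | Lb => b | Lc => c | Ld => d end.

Definition partition_function (R : realType) (n : nat) (a b c d : R) : R :=
  \sum_(M : {set label * {set n.-tuple bool}} | dimer_covering M)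
    \prod_(e in M) label_weight a b c d e.1.

(* Main.v *)
Require Import Defs.
From HB Require Import structures.
From mathcomp Require Import all_boot all_order all_algebra.
From mathcomp Require Import reals.

Set Implicit Arguments.
Unset Strict Implicit.
Unset Printing Implicit Defensive.

Import GRing.Theory Num.Theory.
Local Open Scope ring_scope.

(** The only dimer covering is the set of all [a]-edges.  At every vertex the
    non-loop edges labeled [b], [c], [d] all lead to the same neighbour, so the
    set of vertices that a given covering matches by a [b]-, [c]- or [d]-edge is
    stable under the four generators.  The action being transitive, this set, if
    nonempty, would contain the word [1...1], which [b], [c] and [d] all fix. *)

Lemma act_nseq_true (s : label) (n : nat) :
  s != La -> act s (nseq n true) = nseq n true.
Proof. by elim: n s => [|n IHn] [] //= _; rewrite IHn. Qed.

(** On a word 1...10w, each of [Lb], [Lc], [Ld] keeps the prefix through the first 0 and then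
    applies either [La] or the identity to w. Reading a leading 1 only permutes these three labels,
    hence the induction. *)
Lemma act_moved_eq (s t : label) (w : seq bool) :
  s != La -> t != La -> act s w != w -> act t w != w -> act s w = act t w.
Proof.
elim: w s t => [|[] w IHw] [] [] //= _ _; rewrite ?eqxx // !eqseq_cons //=;
  by move=> h1 h2; congr (_ :: _); apply: IHw.
Qed.

Lemma act_stable_nseq_true (P : seq bool -> Prop) (w : seq bool) :
  (forall s u, P u -> P (act s u)) -> P w -> P (nseq (size w) true).
Proof.
elim: w P => [|x w IHw] P Pact //= Pxw.
apply: (IHw (fun u => P (true :: u))) => [[] u Pu|].
(* The word [aca] sends 1u to 1a(u): flipping the first letter makes [Lc] act on the tail as [La].
   The other three labels on the tail come from [Ld], [Lb], [Lc] directly. *)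
- exact: Pact La _ (Pact Lc _ (Pact La _ Pu)).
- exact: Pact Ld _ Pu.
- exact: Pact Lb _ Pu.
- exact: Pact Lc _ Pu.
- by case: x Pxw => // /(Pact La).
Qed.

Section Edges.

Variable n : nat.
Implicit Types (s : label) (u v : n.-tuple bool).
Implicit Types (e : label * {set n.-tuple bool}).
Implicit Types (M : {set label * {set n.-tuple bool}}).

(** If [s] fixes [v], the pair degenerates to a singleton, which is no edge of the graph. *)
Definition edge s v : label * {set n.-tuple bool} := (s, [set v; tact s v]).

Lemma tactK s : involutive (@tact n s).
Proof. by move=> v; apply: val_inj; rewrite /= actK. Qed.

Lemma edge_tact s v : edge s (tact s v) = edge s v.
Proof. by rewrite /edge tactK setUC. Qed.

Lemma mem_schreier_edges e v : e \in schreier_edges n -> v \in e.2 ->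
  e = edge e.1 v /\ tact e.1 v != v.
Proof.
rewrite inE => /existsP[u /andP[su /eqP e2]].
rewrite e2 !inE => /orP[] /eqP->; last rewrite edge_tact tactK eq_sym;
  by rewrite su [e]surjective_pairing e2.
Qed.

Lemma dimer_edge_ex M v : dimer_covering M -> exists s, edge s v \in M.
Proof.
move=> /andP[/subsetP sM /forallP/(_ v)/cards1P[e /setP/(_ e)]].
rewrite !inE eqxx => /andP[eM ve].
by exists e.1; have [<-] := mem_schreier_edges (sM _ eM) ve.
Qed.

Lemma dimer_edge_moved M s v :
  dimer_covering M -> edge s v \in M -> tact s v != v.
Proof.
move=> /andP[/subsetP sM _] /sM eS.
by have [] := mem_schreier_edges eS (set21 _ _).
Qed.

Lemma dimer_edge_inj M s t v :
  dimer_covering M -> edge s v \in M -> edge t v \in M -> s = t.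
Proof.
move=> /andP[_ /forallP/(_ v)/cards1P[e /setP eE]] sM tM.
have := eE (edge s v); have := eE (edge t v).
by rewrite !inE sM tM !eqxx /= => /esym/eqP<- /esym/eqP[].
Qed.

Lemma dimer_edge_La M s v : dimer_covering M -> edge s v \in M -> s = La.
Proof.
move=> dM svM; apply/eqP; apply: contraT => sa.
(* [P] lives on sequences, since the transitivity argument shortens words. *)
pose P w := exists v t, [/\ val v = w, t != La & edge t v \in M].
have Pact t w : P w -> P (act t w).
  move=> [u [r [<- ra ruM]]]; have [-> | ta] := eqVneq t La.
    have [q quM] := dimer_edge_ex (tact La u) dM.
    exists (tact La u), q; split=> //.
    (* Were a(u) covered by its [La]-edge, that same edge would cover u as well, forcing
       [r = La]. *)
    apply: contra ra => /eqP qa; move: quM; rewrite qa edge_tact => auM.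
    by rewrite (dimer_edge_inj dM ruM auM).
  (* If [t] moves u, it leads to the other endpoint of the edge labeled [r] that covers u. *)
  have [-> | tu] := eqVneq (act t u) u; first by exists u, r.
  exists (tact r u), r; split=> //; last by rewrite edge_tact.
  exact: act_moved_eq ra ta (dimer_edge_moved dM ruM) tu.
have /(act_stable_nseq_true Pact)[u [t [u1 ta tuM]]] : P v by exists v, s.
have := dimer_edge_moved dM tuM.
by rewrite -val_eqE /= u1 act_nseq_true ?eqxx.
Qed.

Lemma dimer_coveringE M :
  (0 < n)%N -> dimer_covering M = (M == [set edge La v | v : n.-tuple bool]).
Proof.
move=> n_gt0; apply/idP/eqP => [dM | ->].
  apply/setP=> e; apply/idP/imsetP => [eM | [v _ ->]]; last first.
    by have [s sM] := dimer_edge_ex v dM; rewrite -(dimer_edge_La dM sM).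
  have /andP[/subsetP sM _] := dM.
  have := sM _ eM; rewrite inE => /existsP[v /andP[_ /eqP e2]].
  have eE : e = edge e.1 v by rewrite [e]surjective_pairing e2.
  have eLa : e.1 = La by apply: (@dimer_edge_La M _ v) => //; rewrite -eE.
  by exists v => //; rewrite eE eLa.
have edgeS v : edge La v \in schreier_edges n.
  rewrite inE; apply/existsP; exists v; rewrite eqxx andbT -val_eqE /=.
  (* [La] moves every word except the empty one, which [0 < n] excludes. *)
  case: v => [[|x w]] /= wn; first by rewrite -(eqP wn) in n_gt0.
  by case: x {wn}.
apply/andP; split; first by apply/subsetP=> _ /imsetP[v _ ->]; apply: edgeS.
apply/forallP=> v; apply/cards1P; exists (edge La v); apply/setP=> e.
rewrite !inE; apply/andP/eqP => [[/imsetP[u _ ->]] vu | ->].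
  by have [] := mem_schreier_edges (edgeS u) vu.
by rewrite imset_f //= set21.
Qed.

End Edges.

Lemma card_La_edges (m : nat) :
  #|[set edge La v | v : m.+1.-tuple bool]| = (2 ^ m)%N.
Proof.
(* Each [La]-edge has exactly one endpoint starting with 0, so the remaining [m] letters parametrize
   these edges. *)
pose f (w : m.-tuple bool) := edge La [tuple of false :: w].
have -> : [set edge La v | v : m.+1.-tuple bool] = f @: setT.
  apply/setP=> e; apply/imsetP/imsetP => [] [v _ ->]; last first.
    by exists [tuple of false :: v].
  exists [tuple of behead v] => //; rewrite /f.
  case/tupleP: v => x w.
  have -> : [tuple of behead [tuple of x :: w]] = w by apply: val_inj.
  case: x => //; rewrite -edge_tact; congr edge; exact: val_inj.
rewrite card_imset ?cardsT ?card_tuple ?card_bool // => u v [/setP].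
move=> /(_ [tuple of false :: u]); rewrite !inE eqxx -!val_eqE /= !eqseq_cons /=.
by rewrite orbF => /esym/eqP/val_inj.
Qed.

Theorem theorem2p2 (R : realType) (n : nat) (hn : (1 <= n)%N) (a b c d : R)
    (ha : 0 < a) (hb : 0 < b) (hc : 0 < c) (hd : 0 < d) :
  partition_function n a b c d = a ^+ (2 ^ (n - 1))%N.
Proof.
rewrite /partition_function (eq_bigl _ _ (fun M => dimer_coveringE M hn)).
rewrite big_pred1_eq (eq_bigr (fun=> a)) => [|_ /imsetP[v _ ->]//].
by case: n hn => // m _; rewrite prodr_const card_La_edges subn1.
Qed.
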